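(* Let $\delta,\theta\in\mathbb{F}_{q^8}$ and let $f(x)=x^q+\delta x^{q^5}$, $g(x)=x^q+\theta x^{q^5}$ be $q$-polynomials over $\mathbb{F}_{q^8}$. Then the linear sets $L_f$ and $L_g$ are $\mathrm{P\Gamma L}(2,q^8)$-equivalent if and only if \[N_{q^8/q^4}(\delta)=N_{q^8/q^4}(\theta)^\sigma\] for some automorphism $\sigma\in\mathrm{Aut}(\mathbb{F}_{q^4})$.
   Context: For a $q$-polynomial $h$ over $\mathbb{F}_{q^n}$, $L_h=\{\langle (x,h(x))\rangle_{\mathbb{F}_{q^n}} : x\in\mathbb{F}_{q^n}^*\}\subseteq\mathrm{PG}(1,q^n)$. Two point sets $L,L'$ of $\mathrm{PG}(1,q^n)$ are $\mathrm{P\Gamma L}$-equivalent if there exists $\varphi\in\mathrm{P\Gamma L}(2,q^n)$ with $L^\varphi=L'$. $N_{q^8/q^4}(x)=x^{q^4+1}$ is the norm from $\mathbb{F}_{q^8}$ to $\mathbb{F}_{q^4}$. *)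

(* Defs.v *)
From mathcomp Require Import all_boot all_order all_fingroup all_algebra all_field.

Set Implicit Arguments.
Unset Strict Implicit.
Unset Printing Implicit Defensive.

Import GRing.Theory.
Local Open Scope ring_scope.

Definition prime_power (q : nat) : Prop :=
  exists p e : nat, [/\ prime p, (0 < e)%N & q = (p ^ e)%N].

Section ProjectiveLine.
Variable L : finFieldType.

Definition pair_rV (x y : L) : 'rV[L]_2 :=
  \row_(i < 2) (if i == 0 then x else y).

(* <v>_L, as the set of its vectors *)
Definition lspan (v : 'rV[L]_2) : {set 'rV[L]_2} := [set a *: v | a : L].

Definition PG1 : {set {set 'rV[L]_2}} := [set lspan v | v : 'rV[L]_2 & v != 0].

Definition linset (h : {poly L}) : {set {set 'rV[L]_2}} :=
  [set lspan (pair_rV x h.[x]) | x : L & x != 0].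

Definition semilin (A : 'M[L]_2) (s : {rmorphism L -> L}) (v : 'rV[L]_2) :
  'rV[L]_2 := map_mx s v *m A.

(* Only the values of phi on PG1 matter: elsewhere phi is unconstrained. *)
Definition PGammaL (phi : {set 'rV[L]_2} -> {set 'rV[L]_2}) : Prop :=
  exists (A : 'M[L]_2) (s : {rmorphism L -> L}),
    [/\ A \in unitmx, bijective s &
        {in PG1, forall P, phi P = semilin A s @: P}].

Definition PGammaL_equiv (X Y : {set {set 'rV[L]_2}}) : Prop :=
  exists2 phi, PGammaL phi & phi @: X = Y.

Definition qpoly15 (q : nat) (d : L) : {poly L} := 'X^q + d *: 'X^(q ^ 5).

Lemma linset_sub_PG1 (h : {poly L}) : linset h \subset PG1.
Proof.
apply/subsetP=> P /imsetP[x]; rewrite inE => x0 ->.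
apply/imsetP; exists (pair_rV x h.[x]) => //; rewrite inE.
by apply/eqP=> /rowP/(_ 0); rewrite !mxE eqxx => /eqP; rewrite (negPf x0).
Qed.

End ProjectiveLine.

Section Norm.
Variables (K L : finFieldType) (iota : {rmorphism K -> L}).

(* The preimage under the embedding iota of x ^ (#|K| + 1): the norm of the
   quadratic extension L / iota K. When #|L| = #|K| ^ 2 the preimage exists,
   so the default value 0 is never used: see relnormE. *)
Definition relnorm (x : L) : K := odflt 0 [pick a | iota a == x ^+ (#|K|).+1].

Lemma relnormE (x : L) : #|L| = (#|K| ^ 2)%N -> iota (relnorm x) = x ^+ (#|K|).+1.
Proof.
move=> cardL; rewrite /relnorm; case: pickP => [a /eqP // | noa].
set y := x ^+ _ in noa.
have yK : y ^+ #|K| = y.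
  by rewrite -exprM mulSn mulnn -cardL exprD expf_card /y exprSr.
have K1 : (1 < #|K|)%N by exact: finNzRing_gt1.
pose p : {poly L} := 'X^#|K| - 'X.
have sp : size p = (#|K|).+1.
  by rewrite size_polyDl ?size_polyXn // size_polyN size_polyX ltnS.
have p0 : p != 0 by rewrite -size_poly_eq0 sp.
have rp z : z ^+ #|K| = z -> root p z.
  by move=> zK; rewrite /root !hornerE zK subrr.
pose r := y :: [seq iota a | a <- enum K].
have /(max_poly_roots p0) : all (root p) r.
  rewrite /= rp //=; apply/allP=> _ /mapP[a _ ->].
  by apply: rp; rewrite -rmorphXn expf_card.
have ur : uniq r.
  rewrite /= map_inj_uniq ?enum_uniq ?andbT; last exact: fmorph_inj.
  by apply/negP=> /mapP[a _ ya]; have := noa a; rewrite -ya eqxx.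
by move=> /(_ ur); rewrite /= size_map -cardE sp ltnn.
Qed.

End Norm.

(* Main.v *)
(* A point of L_f is determined by its slope u = f(x) / x, and the x of a given
   slope form an additive subgroup without 0, so each slope occurs -1 times
   modulo p.  Hence the power sums of f(x) / x over x != 0 only depend on L_f.
   For f = sum a_i x^(q^i), the exponents 1 and 1 + q^j give a_0 and
   a_j a_(8-j)^(q^j); when only a_1, a_5 (or a_3, a_7) are nonzero, the
   exponents 1 + q + q^2 + q^3 and 1 + q^5 + q^2 + q^3 together give the norm of
   the ratio of the two coefficients.
   After a field automorphism an equivalence is a linear fractional map between
   slope sets.  An affine map is settled by these power sums.  Any other map is
   u |-> alpha + beta / (u + gamma); then the slopes of g - alpha x are those of
   beta h^-1 with h = gamma x + f, where h^-1 is again a q-polynomial, and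
   the power sums together with h o h^-1 = id leave only the coefficients
   3, 7 (if gamma = 0) or 0, 1, 5 (otherwise) in h^-1.
   Conversely, Hilbert 90 turns equality of norms into a diagonal equivalence. *)
Require Import Defs.
From mathcomp Require Import all_boot all_order all_fingroup all_algebra.
From mathcomp Require Import all_solvable all_field.
From mathcomp Require Import ring zify.

Set Implicit Arguments.
Unset Strict Implicit.
Unset Printing Implicit Defensive.

Import GRing.Theory.
Local Open Scope ring_scope.

(** * Finite fields *)

Lemma prim_root_neq0 (R : nzRingType) (n : nat) (w : R) :
  n.-primitive_root w -> w != 0.
Proof.
move=> wP; apply: contra_eq_neq (prim_expr_order wP) => ->.
by rewrite expr0n (gtn_eqF (prim_order_gt0 wP)) eq_sym oner_neq0.
Qed.

Section FiniteField.
Variable F : finFieldType.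

(** Translation by [x0] permutes [H], so it preserves the sum over [H], yet it adds [#|H|] times
    [x0] to that sum. *)
Lemma card_addgroup_eq0 (H : {set F}) (x0 : F) :
  x0 != 0 -> (forall x, (x + x0 \in H) = (x \in H)) -> #|H|%:R = 0 :> F.
Proof.
move=> x0n0 Hx0.
have : \sum_(x in H) (x + x0) = \sum_(x in H) x.
  rewrite [RHS](reindex_inj (addIr x0)) /=; apply: eq_bigl => x.
  by rewrite Hx0.
rewrite big_split /= sumr_const -[RHS]addr0 => /addrI /eqP.
by rewrite -[x0 *+ _]mulr_natl mulf_eq0 (negPf x0n0) orbF => /eqP.
Qed.

Lemma natr_card_eq0 : #|F|%:R = 0 :> F.
Proof.
rewrite -cardsT; apply: (@card_addgroup_eq0 _ 1); first exact: oner_neq0.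
by move=> x; rewrite !inE.
Qed.

Lemma finField_card_gt0 : (0 < #|F|.-1)%N.
Proof. by have := finNzRing_gt1 F; case: #|F| => [|[]]. Qed.

Lemma finField_expf_pred (x : F) : x != 0 -> x ^+ #|F|.-1 = 1.
Proof.
move=> x0; apply: (mulfI x0); rewrite mulr1 -exprS prednK ?expf_card //.
by have := finNzRing_gt1 F; case: #|F|.
Qed.

Lemma finField_prim_root : exists w : F, #|F|.-1.-primitive_root w.
Proof.
pose rs := [seq x <- enum F | x != 0].
have srs : size rs = #|F|.-1.
  rewrite -(cardC1 (0 : F)) cardE; congr size.
  by rewrite /rs enumT [RHS]/enum_mem.
have : has (#|F|.-1).-primitive_root rs.
  apply: has_prim_root; rewrite ?finField_card_gt0 ?srs //; last first.
    by apply: filter_uniq; exact: enum_uniq.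
  apply/allP => x; rewrite mem_filter unity_rootE => /andP[x0 _].
  by rewrite finField_expf_pred.
by case/hasP => w _ ?; exists w.
Qed.

(** Scaling the variable by a generator [w] multiplies the sum by [w ^+ m / w ^+ d], which is 1 only
    for congruent exponents. In that case each of the [#|F|.-1] terms is 1. *)
Lemma sum_expf_div (m d : nat) :
  \sum_(x : F | x != 0) x ^+ m / x ^+ d =
  if m == d %[mod #|F|.-1] then -1 else 0.
Proof.
have [w wP] := finField_prim_root.
have w0 := prim_root_neq0 wP.
case: ifP => md.
  rewrite (eq_bigr (fun=> 1)) => [|x x0].
    rewrite sumr_const cardC1; apply/eqP; rewrite -addr_eq0 -mulrSr prednK.
      by rewrite natr_card_eq0.
    by have := finNzRing_gt1 F; case: #|F|.
  have xm k : x ^+ k = x ^+ (k %% #|F|.-1).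
    rewrite {1}(divn_eq k #|F|.-1) exprD mulnC exprM.
    by rewrite finField_expf_pred // expr1n mul1r.
  by rewrite xm (eqP md) -xm divff // expf_neq0.
set T := \sum_(x | _) _.
have wT : T = w ^+ m / w ^+ d * T.
  rewrite {1}/T (reindex_inj (mulfI w0)) /= mulr_sumr.
  apply: eq_big => x; first by rewrite mulf_eq0 (negPf w0).
  by move=> x0; rewrite !exprMn invfM mulrACA.
apply/eqP; case: eqP => // /eqP T0; have : w ^+ m / w ^+ d = 1.
  by apply: (mulIf T0); rewrite mul1r -wT.
by move/divr1_eq/eqP; rewrite (eq_prim_root_expr wP) md.
Qed.

Lemma poly_funE (P Q : {poly F}) : (size P <= #|F|)%N -> (size Q <= #|F|)%N ->
  (forall x, P.[x] = Q.[x]) -> P = Q.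
Proof.
move=> sP sQ PQ; apply/eqP; rewrite -subr_eq0; apply/negPn/negP => D0.
have : all (root (P - Q)) (enum F).
  by apply/allP => x _; rewrite /root hornerD hornerN PQ subrr.
move/(max_poly_roots D0) => /(_ (enum_uniq _)); rewrite -cardE.
rewrite ltnNge => /negP; apply.
by rewrite (leq_trans (size_polyD _ _)) // size_polyN geq_max sP.
Qed.

End FiniteField.

(** * Frobenius powers and automorphisms of a finite field *)

Section Frobenius.
Variables (F : finFieldType) (p n : nat).
Hypotheses (p_pr : prime p) (cardF : #|F| = (p ^ n)%N).

Lemma finField_pchar : p \in [pchar F].
Proof.
rewrite inE p_pr; have := natr_card_eq0 F.
by rewrite cardF natrX => /eqP; rewrite expf_eq0 => /andP[].
Qed.

Lemma exprD_pX (i : nat) (x y : F) :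
  (x + y) ^+ (p ^ i) = x ^+ (p ^ i) + y ^+ (p ^ i).
Proof.
apply: exprDn_pchar; rewrite (eq_pnat _ (pcharf_eq finField_pchar)).
by rewrite pnatX pnat_id.
Qed.

Lemma Frobenius_rmorphism (i : nat) :
  exists s : {rmorphism F -> F}, forall x, s x = x ^+ (p ^ i).
Proof.
elim: i => [|i [s sE]]; first by exists idfun.
exists (pFrobenius_aut finField_pchar \o s) => x /=.
by rewrite pFrobenius_autE sE -exprM expnSr.
Qed.

(** X^p - X has at most [p] roots, and the elements [k%:R] with [k < p] already provide [p] of
    them. *)
Lemma Frobenius_fixed (x : F) : x ^+ p = x -> exists k : nat, x = k%:R.
Proof.
move=> xp; pose rs := [seq k%:R : F | k <- iota 0 p].
have [/mapP[k _ ->]|xn] := boolP (x \in rs); first by exists k.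
have p1 := prime_gt1 p_pr.
pose P : {poly F} := 'X^p - 'X.
have sP : size P = p.+1 by rewrite size_polyDl ?size_polyXn // size_polyN size_polyX ltnS.
have P0 : P != 0 by rewrite -size_poly_eq0 sP.
have rP z : z ^+ p = z -> root P z by move=> zp; rewrite /root !hornerE zp subrr.
have : all (root P) (x :: rs).
  rewrite /= rP //; apply/allP => _ /mapP[k _ ->].
  by rewrite rP // -(pFrobenius_autE finField_pchar) rmorph_nat.
move/(max_poly_roots P0); rewrite /= xn size_map size_iota sP ltnn.
suff -> : uniq rs by move/(_ isT).
rewrite map_inj_in_uniq ?iota_uniq // => i j; rewrite !mem_iota !add0n /=.
wlog ij : i j / (i <= j)%N => [H|] ip jp.
  by case/orP: (leq_total i j) => ? ?; [|apply/esym]; apply: H.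
move/eqP; rewrite eq_sym -subr_eq0 -natrB // -(dvdn_pcharf finField_pchar).
move=> dv; apply/eqP; rewrite eqn_leq ij -subn_eq0 /=.
apply/negPn/negP; rewrite -lt0n => ji; have := dvdn_leq ji dv; lia.
Qed.

Lemma finField_rmorphE (s : {rmorphism F -> F}) :
  exists i : nat, forall x, s x = x ^+ (p ^ i).
Proof.
have [w wP] := finField_prim_root F.
have n0 : (0 < n)%N.
  by have := finNzRing_gt1 F; rewrite cardF; case: (n).
(* The product over the Frobenius orbit of w has coefficients in the prime
   field, so s permutes its roots. *)
pose P : {poly F} := \prod_(i < n) ('X - (w ^+ (p ^ i))%:P).
pose fr : {rmorphism F -> F} := pFrobenius_aut finField_pchar.
(* Frobenius shifts the factors cyclically, since [w ^+ (p ^ n) = w]. *)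
have frP : map_poly fr P = P.
  rewrite map_prod_XsubC /P; case: n n0 cardF => // m _ cF.
  rewrite big_ord_recr big_ord_recl /= [RHS]mulrC; congr (_ * _).
    by apply: eq_bigr => i _; rewrite pFrobenius_autE -exprM -expnSr.
  by rewrite pFrobenius_autE -exprM -expnSr -cF expf_card expn0 expr1.
have sP : map_poly s P = P.
  apply/polyP => j; rewrite coef_map /=.
  have [k ->] : exists k : nat, P`_j = k%:R.
    apply: Frobenius_fixed; rewrite -{2}frP coef_map.
    by rewrite [RHS](pFrobenius_autE finField_pchar).
  by rewrite rmorph_nat.
have : root (map_poly s P) (s w).
  rewrite fmorph_root; apply/rootP; rewrite horner_prod.
  case: n n0 => // m _.
  by rewrite big_ord_recl /= !hornerE subrr mul0r.
rewrite sP /root horner_prod => /prodf_eq0[i _].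
rewrite !hornerE subr_eq0 => /eqP sw; exists i => x.
have [->|x0] := eqVneq x 0.
  by rewrite rmorph0 expr0n expn_eq0 (gtn_eqF (prime_gt0 p_pr)).
have [j ->] := prim_rootP wP (finField_expf_pred x0).
by rewrite rmorphXn /= sw -!exprM mulnC.
Qed.

End Frobenius.

(** * Power sums of slopes *)

(** Reduction modulo [b] reads off the lowest digit; cancelling it and dividing by [b] leaves a
    shorter expansion. *)
Lemma bool_digits_inj (b n : nat) (c c' : nat -> bool) : (1 < b)%N ->
  (\sum_(i < n) c i * b ^ i = \sum_(i < n) c' i * b ^ i)%N ->
  forall i, (i < n)%N -> c i = c' i.
Proof.
move=> b1; elim: n c c' => // n IH c c'; rewrite !big_ord_recl /= !expn0 !muln1.
have shift (d : nat -> bool) : (\sum_(i < n) d (bump 0 i) * b ^ bump 0 i =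
    b * \sum_(i < n) d i.+1 * b ^ i)%N.
  by rewrite big_distrr /=; apply: eq_bigr => i _; rewrite expnS mulnCA.
rewrite !shift => E; have E0 : c 0%N = c' 0%N.
  move/(congr1 (modn^~ b)): (E).
  rewrite ![(_ + b * _)%N]addnC ![(b * _)%N]mulnC !modnMDl.
  by rewrite !modn_small; case: (c _); case: (c' _); rewrite /= ?(ltnW b1).
move: E; rewrite E0 => /addnI/eqP; rewrite eqn_pmul2l ?(ltnW b1) // => /eqP E.
by case=> // i lt_in; apply: (IH (c \o succn) (c' \o succn)).
Qed.

Lemma sum_expn_inj (b n : nat) (A B : {set 'I_n}) : (1 < b)%N ->
  (\sum_(i in A) b ^ i = \sum_(i in B) b ^ i)%N -> A = B.
Proof.
move=> b1; pose c (D : {set 'I_n}) k := k \in [seq val j | j <- enum D].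
have cE (D : {set 'I_n}) (i : 'I_n) : c D i = (i \in D).
  by rewrite /c mem_map ?mem_enum //; exact: val_inj.
have sE (D : {set 'I_n}) : (\sum_(i in D) b ^ i = \sum_(i < n) c D i * b ^ i)%N.
  by rewrite big_mkcond; apply: eq_bigr => i _; rewrite cE; case: ifP; rewrite ?mul1n.
rewrite !sE => /(bool_digits_inj b1) cAB; apply/setP => i.
by rewrite -!cE cAB.
Qed.

(** * q-polynomials over the field of order q^8 and their composition *)

Section QPolynomials.
Variables (q : nat) (L : finFieldType).
Hypotheses (q_pp : prime_power q) (cardL : #|L| = (q ^ 8)%N).

Lemma prime_power_gt1 : (1 < q)%N.
Proof.
by case: q_pp => p [e [p_pr e0 ->]]; rewrite -(exp1n e) ltn_exp2r ?prime_gt1.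
Qed.

Let q_gt1 := prime_power_gt1.
Let q_gt0 : (0 < q)%N. Proof. exact: ltnW. Qed.

Lemma frobD (i : nat) (x y : L) :
  (x + y) ^+ (q ^ i) = x ^+ (q ^ i) + y ^+ (q ^ i).
Proof.
case: q_pp => p [e [p_pr e0 qE]].
by rewrite qE -expnM; apply: (exprD_pX p_pr (n := e * 8)); rewrite cardL qE expnM.
Qed.

Lemma frob0 (i : nat) : 0 ^+ (q ^ i) = 0 :> L.
Proof. by rewrite expr0n expn_eq0 (gtn_eqF q_gt0). Qed.

Lemma frob_eq0 (i : nat) (x : L) : (x ^+ (q ^ i) == 0) = (x == 0).
Proof. by rewrite expf_eq0 expn_gt0 q_gt0. Qed.

Lemma frobN (i : nat) (x : L) : (- x) ^+ (q ^ i) = - x ^+ (q ^ i).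
Proof.
by apply/eqP; rewrite -addr_eq0 -frobD addNr frob0.
Qed.

Lemma frob_sum (i : nat) (I : finType) (E : I -> L) :
  (\sum_k E k) ^+ (q ^ i) = \sum_k E k ^+ (q ^ i).
Proof. by elim/big_rec2: _ => [|k x y _ <-]; rewrite ?frob0 ?frobD. Qed.

Lemma frob8 (x : L) : x ^+ (q ^ 8) = x.
Proof. by rewrite -cardL expf_card. Qed.

Lemma frob_mod (i : nat) (x : L) : x ^+ (q ^ (i %% 8)) = x ^+ (q ^ i).
Proof.
rewrite {2}(divn_eq i 8) expnD exprM; congr (_ ^+ _).
by elim: (i %/ 8)%N => [|k IH]; rewrite ?mul0n ?expn0 ?expr1 // mulSn expnD exprM frob8.
Qed.

Lemma frob_frob (i j : nat) (x : L) :
  (x ^+ (q ^ i)) ^+ (q ^ j) = x ^+ (q ^ ((i + j) %% 8)).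
Proof. by rewrite frob_mod -exprM expnD. Qed.

Definition qp (a : nat -> L) (x : L) : L := \sum_(i < 8) a i * x ^+ (q ^ i).

Lemma qpD (a : nat -> L) (x y : L) : qp a (x + y) = qp a x + qp a y.
Proof.
by rewrite -big_split; apply: eq_bigr => i _; rewrite frobD mulrDr.
Qed.

Lemma qp0 (a : nat -> L) : qp a 0 = 0.
Proof. by apply: big1 => i _; rewrite frob0 mulr0. Qed.

(* Multiplication in L[X] / (X^8 - 1) twisted by the Frobenius; the index is
   shifted by 8 to keep the natural subtraction exact. *)
Definition qcomp (a b : nat -> L) (k : nat) : L :=
  \sum_(i < 8) a i * b ((k + 8 - i) %% 8)%N ^+ (q ^ i).

Lemma qp_comp (a b : nat -> L) (x : L) : qp a (qp b x) = qp (qcomp a b) x.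
Proof.
rewrite /qp /qcomp.
under [RHS]eq_bigr do rewrite mulr_suml.
rewrite exchange_big; apply: eq_bigr => i _ /=.
(* Replacing the inner index [k] by [k - i] in Z/8 collects the contributions to the exponent
   [q ^ k]. *)
rewrite frob_sum mulr_sumr (reindex_inj (addIr (- i))) /=.
apply: eq_bigr => k _; rewrite exprMn mulrA.
have -> : (k + (8 - i) %% 8 = k + 8 - i %[mod 8])%N.
  by rewrite modnDmr addnBA // ltnW.
rewrite frob_frob modnDml subnK ?modnDr ?frob_mod //.
by rewrite (leq_trans (ltnW (ltn_ord i))) ?leq_addl.
Qed.

(** The associated polynomials have degree at most q^7, below [#|L|], so their values determine
    their coefficients. *)
Lemma qp_inj (a b : nat -> L) :
  (forall x, qp a x = qp b x) -> forall i, (i < 8)%N -> a i = b i.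
Proof.
pose P (c : nat -> L) : {poly L} := \sum_(i < 8) c i *: 'X^(q ^ i).
have PE c x : (P c).[x] = qp c x.
  by rewrite horner_sum; apply: eq_bigr => i _; rewrite !hornerE.
have sP c : (size (P c) <= #|L|)%N.
  apply: (leq_trans (size_sum _ _ _)); apply/bigmax_leqP => i _.
  apply: (leq_trans (size_scale_leq _ _)); rewrite size_polyXn cardL.
  by rewrite ltn_exp2l.
have Pc c i : (i < 8)%N -> (P c)`_(q ^ i) = c i.
  move=> i8; rewrite coef_sum (bigD1 (Ordinal i8)) //= coefZ coefXn eqxx mulr1.
  rewrite big1 ?addr0 // => j ji; rewrite coefZ coefXn eqn_exp2l // eq_sym.
  by case: eqP => [E|]; rewrite ?mulr0 //; case/eqP: ji; apply: val_inj.
move=> ab i i8; rewrite -[a i]Pc // -[b i]Pc //.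
by congr (_`_ _); congr polyseq; apply: poly_funE => // x; rewrite !PE.
Qed.

(** * Slope sets and their power sums of exponents 1 and 1 + q^j *)

Definition slopes (a : nat -> L) : {set L} :=
  [set qp a x / x | x : L & x != 0].

Lemma slopesP (a : nat -> L) (u : L) :
  reflect (exists2 x, x != 0 & qp a x = u * x) (u \in slopes a).
Proof.
apply: (iffP imsetP) => [[x]|[x x0 E]]; rewrite ?inE.
  by move=> x0 ->; exists x; rewrite ?divfK.
by exists x; rewrite ?inE // E mulfK.
Qed.

(* Each slope is attained on a nonzero additive subgroup with 0 removed, that
   is -1 times modulo the characteristic. *)
Lemma sum_slopes (a : nat -> L) (E : L -> L) :
  \sum_(x | x != 0) E (qp a x / x) = - \sum_(u in slopes a) E u.
Proof.
rewrite (eq_bigl (fun x => x \in [set x : L | x != 0])) => [|x]; last by rewrite inE.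
rewrite (partition_big_imset (fun x => qp a x / x)) /= -sumrN.
apply: eq_bigr => u /slopesP[x0 x0n0 ux0].
pose H := [set x : L | qp a x == u * x].
have HE : #|H|%:R = 0 :> L.
  apply: (card_addgroup_eq0 x0n0) => x.
  by rewrite !inE qpD mulrDr ux0 (inj_eq (addIr _)).
rewrite (eq_bigr (fun=> E u)) => [|x /andP[_ /eqP->]] //.
rewrite sumr_const -mulr_natl; apply/eqP; rewrite -addr_eq0 -{2}[E u]mul1r -mulrDl.
rewrite mulf_eq0; apply/orP; left; rewrite natr1.
apply/eqP; apply: etrans HE; congr _%:R.
rewrite (cardsD1 0 H) inE qp0 mulr0 eqxx add1n; congr _.+1.
apply: eq_card => x; rewrite unfold_in /= !inE.
by case: eqP => //= /eqP x0'; rewrite -(inj_eq (mulIf x0')) divfK.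
Qed.

Lemma eq_slopes_sum (a b : nat -> L) (E : L -> L) : slopes a = slopes b ->
  \sum_(x | x != 0) E (qp a x / x) = \sum_(x | x != 0) E (qp b x / x).
Proof. by move=> ab; rewrite !sum_slopes ab. Qed.

Let N_gt : (q ^ 7 + 2 < q ^ 8 - 1 /\ 2 * q ^ 7 <= q ^ 8)%N.
Proof.
have : (2 ^ 7 <= q ^ 7)%N by rewrite leq_exp2r.
have : (2 * q ^ 7 <= q ^ 8)%N by rewrite (expnS q 7) leq_mul2r q_gt1 orbT.
lia.
Qed.

Let expq_le7 (i : nat) : (i < 8)%N -> (q ^ i <= q ^ 7)%N.
Proof. by move=> i8; rewrite leq_exp2l. Qed.

Lemma expn_mod_card1 (i : nat) : (i < 8)%N ->
  (q ^ i == 1 %[mod #|L|.-1]) = (i == 0%N).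
Proof.
move=> /expq_le7 qi; rewrite cardL -subn1 !modn_small; try lia.
by rewrite -[X in _ == X](expn0 q) eqn_exp2l.
Qed.

Lemma expn_mod_card2 (i k j : nat) : (i < 8)%N -> (k < 8)%N -> (0 < j < 8)%N ->
  (q ^ i + q ^ k == 1 + q ^ j %[mod #|L|.-1]) =
  (i == 0%N) && (k == j) || (i == j) && (k == 0%N).
Proof.
move=> i8 k8 /andP[j0 j8].
have [qi qk qj] := And3 (expq_le7 i8) (expq_le7 k8) (expq_le7 j8).
have [N1 N2] := N_gt.
have d_gt1 : (1 < q ^ j)%N by rewrite -(expn0 q) ltn_exp2l.
apply/eqP/idP; last first.
  by case/orP => /andP[/eqP-> /eqP->]; rewrite expn0 // addnC.
rewrite cardL -subn1 [RHS]modn_small; last lia.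
(* The left sum is at most 2 q^7 <= q^8, so once it reaches q^8 - 1 its residue is at most 1, which
   is less than 1 + q^j. *)
have [lt_mN|le_Nm] := ltnP (q ^ i + q ^ k) (q ^ 8 - 1); last first.
  rewrite -(subnK le_Nm) modnDr modn_small; lia.
rewrite modn_small // => E.
(* Divisibility by [q] then forces one of [i] and [k] to be 0. *)
have dvd1 : ~~ (q %| 1 + q ^ j)%N.
  by rewrite dvdn_addl ?dvdn1 ?gtn_eqF // dvdn_exp.
case: i i8 qi E {lt_mN} => [|i] i8 qi E.
  move/eqP: E; rewrite expn0 eqn_add2l eqn_exp2l // => ->; exact: orTb.
case: k k8 qk E => [|k] k8 qk E.
  by move/eqP: E; rewrite expn0 addnC eqn_add2l eqn_exp2l // => ->.
by move: dvd1; rewrite -E dvdn_add // dvdn_exp.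
Qed.

Lemma sum_slope1 (a : nat -> L) : \sum_(x | x != 0) qp a x / x = - a 0%N.
Proof.
have E x : qp a x / x = \sum_(i < 8) a i * (x ^+ (q ^ i) / x ^+ 1).
  by rewrite mulr_suml; apply: eq_bigr => i _; rewrite mulrA.
under eq_bigr do rewrite E.
rewrite exchange_big /= (eq_bigr (fun i : 'I_8 => a i *
   (if i == 0%N :> nat then -1 else 0))) => [|i _]; last first.
  by rewrite -mulr_sumr sum_expf_div expn_mod_card1.
rewrite big_ord_recl /= mulrN1 big1 ?addr0 // => i _.
by rewrite mulr0.
Qed.

(** This is composition on the left with the monomial of exponent q^j, whose coefficient sequence is
    [m]. *)
Lemma frob_qp (a : nat -> L) (j : nat) (x : L) : (j < 8)%N ->
  qp a x ^+ (q ^ j) = qp (fun k => a ((k + 8 - j) %% 8)%N ^+ (q ^ j)) x.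
Proof.
move=> j8; pose m (i : nat) : L := if i == j then 1 else 0.
have sum_m (E : nat -> L) : \sum_(i < 8) m i * E i = E j.
  rewrite (bigD1 (Ordinal j8)) //= /m eqxx mul1r big1 ?addr0 // => i ij.
  by case: eqP => [E1|]; rewrite ?mul0r //; case/eqP: ij; apply: val_inj.
have mE y : qp m y = y ^+ (q ^ j) by exact: (sum_m (fun i => y ^+ (q ^ i))).
rewrite -mE qp_comp; apply: eq_bigr => k _; congr (_ * _).
exact: (sum_m (fun i => a ((k + 8 - i) %% 8)%N ^+ (q ^ i))).
Qed.

(** In the expanded product only the index pairs (0, j) and (j, 0) have an exponent congruent to 1 +
    q^j. *)
Lemma sum_slope2 (a : nat -> L) (j : nat) : (0 < j < 8)%N ->
  \sum_(x | x != 0) qp a x / x * (qp a x / x) ^+ (q ^ j) =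
  - (a 0%N * a 0%N ^+ (q ^ j) + a j * a (8 - j)%N ^+ (q ^ j)).
Proof.
move=> /[dup] jP /andP[j0 j8].
pose b k := a ((k + 8 - j) %% 8)%N ^+ (q ^ j).
have E x : qp a x / x * (qp a x / x) ^+ (q ^ j) = \sum_(i < 8) \sum_(k < 8)
     a i * b k * (x ^+ (q ^ i + q ^ k) / x ^+ (1 + q ^ j)).
  rewrite expr_div_n frob_qp // mulrACA -invfM -exprS -add1n /qp.
  rewrite mulr_suml mulr_suml; apply: eq_bigr => i _.
  rewrite mulr_sumr mulr_suml; apply: eq_bigr => k _.
  by rewrite -/(b k) (exprD x (q ^ i)); ring.
under eq_bigr do rewrite E.
rewrite exchange_big /= (eq_bigr (fun i : 'I_8 => \sum_(k < 8) a i * b k *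
   (if (i == 0%N :> nat) && (k == j :> nat) || (i == j :> nat) && (k == 0%N :> nat)
    then -1 else 0))) => [|i _]; last first.
  rewrite exchange_big; apply: eq_bigr => k _ /=.
  by rewrite -mulr_sumr sum_expf_div expn_mod_card2.
rewrite pair_big /= (bigD1 (ord0, Ordinal j8)) //= eqxx /=.
have j0' : (j == 0%N) = false by rewrite gtn_eqF.
rewrite (bigD1 (Ordinal j8, ord0)) /=; last first.
  by rewrite xpair_eqE -!val_eqE /= j0'.
rewrite !eqxx orbT big1 => [|[i k] /=]; last first.
  rewrite !xpair_eqE -!val_eqE /= => /andP[/negPf n1 /negPf n2].
  by rewrite n1 n2 mulr0.
by rewrite addr0 /b addnC addnK modnn add0n modn_small ?mulrN1 ?opprD //; lia.
Qed.

Lemma eq_slopes0 (a b : nat -> L) : slopes a = slopes b -> a 0%N = b 0%N.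
Proof.
move=> /(eq_slopes_sum (fun u => u)); rewrite !sum_slope1; exact: oppr_inj.
Qed.

Lemma eq_slopes2 (a b : nat -> L) (j : nat) : (0 < j < 8)%N ->
  slopes a = slopes b ->
  a j * a (8 - j)%N ^+ (q ^ j) = b j * b (8 - j)%N ^+ (q ^ j).
Proof.
move=> jP ab; have := eq_slopes_sum (fun u => u * u ^+ (q ^ j)) ab.
by rewrite !sum_slope2 // (eq_slopes0 ab) => /oppr_inj/addrI.
Qed.

(** * Power sums with four Frobenius factors for two-term q-polynomials *)

Definition two_term (s : nat) (A B : L) (i : nat) : L :=
  if i == s then A else if i == (s + 4)%N then B else 0.

Lemma qp_two_term (s : nat) (A B x : L) : (s < 4)%N ->
  qp (two_term s A B) x = A * x ^+ (q ^ s) + B * x ^+ (q ^ (s + 4)).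
Proof.
move=> s4; rewrite /qp !big_ord_recl big_ord0 /= /bump /=.
by case: s s4 => [|[|[|[|]]]] //= _; rewrite /two_term /=; ring.
Qed.

(** Expanding the product, [f] records which factors contribute their [B]-term, and [r f i] is the
    resulting Frobenius index of factor [i]. The term survives only if these indices form the same
    set as the [t i]. As the [t i] are distinct modulo 4, [b] is the only such choice, and [pi]
    matches the indices. *)
Lemma sum_slope4 (s : nat) (A B : L) (t : 'I_4 -> 'I_8) (b : 'I_4 -> bool)
    (pi : 'I_4 -> 'I_4) :
  (s < 4)%N ->
  (forall i j, (t i = t j %[mod 4])%N -> i = j) ->
  (forall i, t (pi i) = (t i + s + 4 * b i) %% 8 :> nat)%N ->
  \sum_(x | x != 0) \prod_i (qp (two_term s A B) x / x) ^+ (q ^ t i) =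
  - \prod_i (if b i then B else A) ^+ (q ^ t i).
Proof.
move=> s4 t_inj4 t_pi.
have [r rE] : exists r : {ffun 'I_4 -> bool} -> 'I_4 -> 'I_8,
    forall f i, r f i = ((t i + s + 4 * f i) %% 8)%N :> nat.
  by exists (fun (f : {ffun 'I_4 -> bool}) i => inZp (t i + s + 4 * f i)).
have m4 m c : ((m + 4 * c) %% 4 = m %% 4)%N by rewrite addnC mulnC modnMDl.
have t_inj : injective t by move=> i j tij; apply: t_inj4; rewrite tij.
have r_inj f : injective (r f).
  move=> i j rij; apply: t_inj4; apply/eqP; rewrite -(eqn_modDr s); apply/eqP.
  have := congr1 (fun k : 'I_8 => k %% 4)%N rij; rewrite !rE !modn_dvdm //.
  by rewrite !m4.
have sum_set (u : 'I_4 -> 'I_8) : injective u ->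
    (\sum_i q ^ u i = \sum_(k in u @: 'I_4) q ^ k)%N.
  by move=> u_inj; rewrite big_imset //= => i j _ _; apply: u_inj.
(* Four distinct powers sum to strictly less than all eight, hence less than q^8 - 1; so congruence
   of exponents is equality, and base-q digits apply. *)
have sum_lt (u : 'I_4 -> 'I_8) : injective u -> (\sum_i q ^ u i < #|L|.-1)%N.
  move=> u_inj; rewrite cardL predn_exp.
  have cu : #|~: (u @: 'I_4)| = 4%N.
    by have := cardsC (u @: 'I_4); rewrite card_imset // !card_ord; lia.
  apply: (@leq_trans (\sum_(i < 8) q ^ i)); last first.
    by rewrite leq_pmull // -subn1 subn_gt0.
  rewrite sum_set // [ltnRHS](bigID (mem (u @: 'I_4))) /=.
  rewrite -[ltnLHS]addn0 ltn_add2l.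
  have [k kP] : exists k, k \in ~: (u @: 'I_4) by apply/card_gt0P; rewrite cu.
  by rewrite (bigD1 k) ?addn_gt0 ?expn_gt0 ?q_gt0 //; rewrite inE in kP.
pose C (i : 'I_4) (c : bool) : L := (if c then B else A) ^+ (q ^ t i).
have E x : \prod_i (qp (two_term s A B) x / x) ^+ (q ^ t i) =
    \sum_(f : {ffun 'I_4 -> bool}) (\prod_i C i (f i)) *
      (x ^+ (\sum_i q ^ r f i) / x ^+ (\sum_i q ^ t i)).
  have sumX (u : 'I_4 -> nat) : x ^+ (\sum_i u i) = \prod_i x ^+ u i.
    exact: (big_morph _ (exprD x) (expr0 x)).
  under eq_bigr => i _.
    rewrite expr_div_n qp_two_term // frobD !exprMn !frob_frob.
    have -> : A ^+ (q ^ t i) * x ^+ (q ^ ((s + t i) %% 8)) +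
        B ^+ (q ^ t i) * x ^+ (q ^ ((s + 4 + t i) %% 8)) =
        \sum_(c : bool) C i c * x ^+ (q ^ ((t i + s + 4 * c) %% 8)).
      rewrite big_bool /= addrC /C muln0 addn0 muln1 (addnC s).
      by rewrite (addnC (s + 4)) addnA.
    over.
  rewrite prodf_div; rewrite bigA_distr_bigA mulr_suml.
  apply: eq_bigr => f _; rewrite big_split /= !sumX mulrA.
  by congr (_ * _ / _); apply: eq_bigr => i _; rewrite rE.
rewrite (eq_bigr _ (fun x _ => E x)).
rewrite exchange_big (bigD1 [ffun i => b i]) //= -mulr_sumr sum_expf_div.
have -> : (\sum_i q ^ r [ffun i => b i] i = \sum_i q ^ t i)%N.
  have pi_inj : injective pi.
    move=> i j pij; apply: (r_inj [ffun i => b i]); apply: val_inj => /=.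
    by rewrite !rE !ffunE -!t_pi pij.
  rewrite [RHS](reindex_inj pi_inj); apply: eq_bigr => i _.
  by rewrite t_pi rE ffunE.
rewrite eqxx mulrN1 [X in _ + X]big1 ?addr0.
  by congr (- _); apply: eq_bigr => i _; rewrite ffunE.
move=> f fb; rewrite -mulr_sumr sum_expf_div ifF ?mulr0 //.
apply: contraNF fb; rewrite !modn_small ?sum_lt // => /eqP.
rewrite !sum_set // => /(sum_expn_inj q_gt1) rt.
apply/eqP/ffunP => i; rewrite ffunE.
(* The residue modulo 4 identifies the matching index as [pi i]; the residue modulo 8 then gives
   [f i = b i]. *)
have /imsetP[j _ rfj] : r f i \in t @: 'I_4 by rewrite -rt imset_f.
have jE : j = pi i.
  apply: t_inj4; rewrite -rfj rE t_pi !modn_dvdm //.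
  by rewrite !m4.
have := congr1 val rfj; rewrite jE /= rE t_pi.
by case: (f i); case: (b i) => //=; have := ltn_ord (t i); lia.
Qed.

(* The exponent sets {0, 1, 2, 3} and {0, 5, 2, 3}. *)
Definition run4 (i : 'I_4) : 'I_8 := inZp i.
Definition run4_twist (i : 'I_4) : 'I_8 := inZp (i + 4 * (i == 1 :> nat)).

Lemma run4_inj (i j : 'I_4) : (run4 i = run4 j %[mod 4])%N -> i = j.
Proof.
by move: i j; do 2!case=> [[|[|[|[|?]]]] ?] //=; move=> _; apply: val_inj.
Qed.

Lemma run4_twist_inj (i j : 'I_4) :
  (run4_twist i = run4_twist j %[mod 4])%N -> i = j.
Proof.
by move: i j; do 2!case=> [[|[|[|[|?]]]] ?] //=; move=> _; apply: val_inj.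
Qed.

(** Adding 1 to {0, 1, 2, 3} gives {1, 2, 3, 4}; only 4 has to move by 4, back to 0, so [B] enters
    through the last factor alone. *)
Lemma sum_slope_run4_15 (A B : L) : \sum_(x | x != 0)
    \prod_i (qp (two_term 1 A B) x / x) ^+ (q ^ run4 i) =
  - (A ^+ (q ^ 0) * A ^+ (q ^ 1) * A ^+ (q ^ 2) * B ^+ (q ^ 3)).
Proof.
rewrite (@sum_slope4 1 A B _ (fun i => i == 3 :> nat) (@ordS 4)) //.
- by rewrite !big_ord_recl big_ord0 mulr1 !mulrA.
- exact: run4_inj.
- by case=> [[|[|[|[|?]]]] ?].
Qed.

(** Adding 1 to {0, 5, 2, 3} gives {1, 6, 3, 4}; all but 3 must move by 4, so [A] stays only in the
    factor of index 2. *)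
Lemma sum_slope_run4_twist_15 (A B : L) : \sum_(x | x != 0)
    \prod_i (qp (two_term 1 A B) x / x) ^+ (q ^ run4_twist i) =
  - (B ^+ (q ^ 0) * B ^+ (q ^ 5) * A ^+ (q ^ 2) * B ^+ (q ^ 3)).
Proof.
rewrite (@sum_slope4 1 A B _ (fun i => i != 2 :> nat) (@ordS 4)) //.
- by rewrite !big_ord_recl big_ord0 mulr1 !mulrA.
- exact: run4_twist_inj.
- by case=> [[|[|[|[|?]]]] ?].
Qed.

(** Adding 3 gives {3, 4, 5, 6}, where all but 3 must move by 4; the matching is now the backward
    cyclic shift. *)
Lemma sum_slope_run4_37 (A B : L) : \sum_(x | x != 0)
    \prod_i (qp (two_term 3 A B) x / x) ^+ (q ^ run4 i) =
  - (A ^+ (q ^ 0) * B ^+ (q ^ 1) * B ^+ (q ^ 2) * B ^+ (q ^ 3)).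
Proof.
rewrite (@sum_slope4 3 A B _ (fun i => i != 0 :> nat) (@ord_pred 4)) //.
- by rewrite !big_ord_recl big_ord0 mulr1 !mulrA.
- exact: run4_inj.
- by case=> [[|[|[|[|?]]]] ?].
Qed.

Lemma sum_slope_run4_twist_37 (A B : L) : \sum_(x | x != 0)
    \prod_i (qp (two_term 3 A B) x / x) ^+ (q ^ run4_twist i) =
  - (A ^+ (q ^ 0) * A ^+ (q ^ 5) * A ^+ (q ^ 2) * B ^+ (q ^ 3)).
Proof.
rewrite (@sum_slope4 3 A B _ (fun i => i == 3 :> nat) (@ord_pred 4)) //.
- by rewrite !big_ord_recl big_ord0 mulr1 !mulrA.
- exact: run4_twist_inj.
- by case=> [[|[|[|[|?]]]] ?].
Qed.

(** The first sum expresses [theta] as [rho] times four conjugates of [A]. Hence the norm of [theta]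
    is that of [rho] times the product of all eight conjugates of [A], and the twisted sum makes
    this product 1 when [rho] is nonzero. *)
Lemma eq_slopes_norm15 (A rho theta : L) : A != 0 ->
  slopes (two_term 1 A (A * rho)) = slopes (two_term 1 1 theta) ->
  theta * theta ^+ (q ^ 4) = rho * rho ^+ (q ^ 4).
Proof.
move=> A0 AB.
have := eq_slopes_sum (fun u => \prod_i u ^+ (q ^ run4 i)) AB.
have := eq_slopes_sum (fun u => \prod_i u ^+ (q ^ run4_twist i)) AB.
rewrite /= !sum_slope_run4_twist_15 !sum_slope_run4_15.
move=> /oppr_inj E2 /oppr_inj E1; rewrite !expr1n !mul1r ?mulr1 in E1 E2.
(* All conjugates of [E1]; j = 5 gives [theta] itself, because 3 + 5 is 0 modulo 8. *)
have F j : theta ^+ (q ^ ((3 + j) %% 8)) =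
    A ^+ (q ^ ((0 + j) %% 8)) * A ^+ (q ^ ((1 + j) %% 8)) *
    A ^+ (q ^ ((2 + j) %% 8)) *
    (A ^+ (q ^ ((3 + j) %% 8)) * rho ^+ (q ^ ((3 + j) %% 8))).
  by rewrite -!frob_frob -E1 !exprMn.
have T0 : theta ^+ (q ^ 0) = A ^+ (q ^ 5) * A ^+ (q ^ 6) * A ^+ (q ^ 7) *
   (A ^+ (q ^ 0) * rho ^+ (q ^ 0)) := F 5.
have T3 : theta ^+ (q ^ 3) = A ^+ (q ^ 0) * A ^+ (q ^ 1) * A ^+ (q ^ 2) *
   (A ^+ (q ^ 3) * rho ^+ (q ^ 3)) := F 0%N.
have T4 : theta ^+ (q ^ 4) = A ^+ (q ^ 1) * A ^+ (q ^ 2) * A ^+ (q ^ 3) *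
   (A ^+ (q ^ 4) * rho ^+ (q ^ 4)) := F 1%N.
have T5 : theta ^+ (q ^ 5) = A ^+ (q ^ 2) * A ^+ (q ^ 3) * A ^+ (q ^ 4) *
   (A ^+ (q ^ 5) * rho ^+ (q ^ 5)) := F 2.
change (theta ^+ (q ^ 0) * theta ^+ (q ^ 4) = rho ^+ (q ^ 0) * rho ^+ (q ^ 4)).
rewrite T0 T4.
have [->|r0] := eqVneq rho 0; first by rewrite !frob0 !mulr0.
have := E2; rewrite T0 T3 T5 !exprMn.
have nz (z : L) (i : nat) : z != 0 -> z ^+ (q ^ i) != 0 by rewrite frob_eq0.
move: (nz A 0%N A0) (nz A 2 A0) (nz A 3 A0) (nz A 5 A0).
move: (nz rho 0%N r0) (nz rho 3 r0) (nz rho 5 r0).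
move: (A ^+ (q ^ 0)) (A ^+ (q ^ 1)) (A ^+ (q ^ 2)) (A ^+ (q ^ 3)) (A ^+ (q ^ 4))
  (A ^+ (q ^ 5)) (A ^+ (q ^ 6)) (A ^+ (q ^ 7)).
move: (rho ^+ (q ^ 0)) (rho ^+ (q ^ 3)) (rho ^+ (q ^ 4)) (rho ^+ (q ^ 5)).
move=> r0' r3 r4 r5 a0 a1 a2 a3 a4 a5 a6 a7 r0n r3n r5n a0n a2n a3n a5n E.
(* Substituting the conjugates of [theta] in [E2] yields this product times a nonzero factor common
   to both sides. *)
have N1 : a0 * a1 * a2 * a3 * a4 * a5 * a6 * a7 = 1.
  apply: (mulfI (x := a0 * a2 * a3 * a5 * r0' * r3 * r5)); first by rewrite !mulf_neq0.
  by rewrite mulr1; transitivity (a0 * r0' * (a5 * r5) * a2 * (a3 * r3));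
    [rewrite E|]; ring.
by transitivity (a0 * a1 * a2 * a3 * a4 * a5 * a6 * a7 * (r0' * r4));
  [ring|rewrite N1 mul1r].
Qed.

(** Same elimination as for indices 1 and 5, but [theta] now contains [rho ^+ (q ^ 5)] instead of
    [rho], whence the extra Frobenius. *)
Lemma eq_slopes_norm37 (A rho theta : L) : A != 0 ->
  slopes (two_term 3 (A * rho) A) = slopes (two_term 1 1 theta) ->
  theta * theta ^+ (q ^ 4) = (rho * rho ^+ (q ^ 4)) ^+ q.
Proof.
move=> A0 AB.
have := eq_slopes_sum (fun u => \prod_i u ^+ (q ^ run4 i)) AB.
have := eq_slopes_sum (fun u => \prod_i u ^+ (q ^ run4_twist i)) AB.
rewrite /= !sum_slope_run4_twist_15 !sum_slope_run4_15.
rewrite !sum_slope_run4_twist_37 !sum_slope_run4_37.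
move=> /oppr_inj E2 /oppr_inj E1; rewrite !expr1n !mul1r ?mulr1 in E1 E2.
have F j : theta ^+ (q ^ ((3 + j) %% 8)) =
    A ^+ (q ^ ((0 + j) %% 8)) * rho ^+ (q ^ ((0 + j) %% 8)) *
    A ^+ (q ^ ((1 + j) %% 8)) *
    A ^+ (q ^ ((2 + j) %% 8)) * A ^+ (q ^ ((3 + j) %% 8)).
  by rewrite -!frob_frob -E1 !exprMn.
have T0 : theta ^+ (q ^ 0) = A ^+ (q ^ 5) * rho ^+ (q ^ 5) * A ^+ (q ^ 6) *
   A ^+ (q ^ 7) * A ^+ (q ^ 0) := F 5.
have T3 : theta ^+ (q ^ 3) = A ^+ (q ^ 0) * rho ^+ (q ^ 0) * A ^+ (q ^ 1) *
   A ^+ (q ^ 2) * A ^+ (q ^ 3) := F 0%N.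
have T4 : theta ^+ (q ^ 4) = A ^+ (q ^ 1) * rho ^+ (q ^ 1) * A ^+ (q ^ 2) *
   A ^+ (q ^ 3) * A ^+ (q ^ 4) := F 1%N.
have T5 : theta ^+ (q ^ 5) = A ^+ (q ^ 2) * rho ^+ (q ^ 2) * A ^+ (q ^ 3) *
   A ^+ (q ^ 4) * A ^+ (q ^ 5) := F 2.
rewrite exprMn -exprM -expnSr.
change (theta ^+ (q ^ 0) * theta ^+ (q ^ 4) = rho ^+ (q ^ 1) * rho ^+ (q ^ 5)).
rewrite T0 T4.
have [->|r0] := eqVneq rho 0; first by rewrite !frob0 !(mulr0, mul0r).
have := E2; rewrite T0 T3 T5 !exprMn.
have nz (z : L) (i : nat) : z != 0 -> z ^+ (q ^ i) != 0 by rewrite frob_eq0.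
move: (nz A 0%N A0) (nz A 2 A0) (nz A 3 A0) (nz A 5 A0).
move: (nz rho 0%N r0) (nz rho 2 r0) (nz rho 5 r0).
move: (A ^+ (q ^ 0)) (A ^+ (q ^ 1)) (A ^+ (q ^ 2)) (A ^+ (q ^ 3)) (A ^+ (q ^ 4))
  (A ^+ (q ^ 5)) (A ^+ (q ^ 6)) (A ^+ (q ^ 7)).
move: (rho ^+ (q ^ 0)) (rho ^+ (q ^ 1)) (rho ^+ (q ^ 2)) (rho ^+ (q ^ 5)).
move=> r0' r1 r2 r5 a0 a1 a2 a3 a4 a5 a6 a7 r0n r2n r5n a0n a2n a3n a5n E.
have N1 : a0 * a1 * a2 * a3 * a4 * a5 * a6 * a7 = 1.
  apply: (mulfI (x := a0 * a2 * a3 * a5 * r0' * r2 * r5)); first by rewrite !mulf_neq0.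
  by rewrite mulr1; transitivity (a0 * r0' * (a5 * r5) * (a2 * r2) * a3);
    [rewrite E|]; ring.
by transitivity (a0 * a1 * a2 * a3 * a4 * a5 * a6 * a7 * (r1 * r5));
  [ring|rewrite N1 mul1r].
Qed.

(** An injective [qp h] is a permutation of a finite set, so its inverse is one of its iterates, and
    these are again q-polynomials. *)
Lemma qp_inverse (h : nat -> L) : injective (qp h) ->
  exists e, forall y, qp h (qp e y) = y.
Proof.
move=> h_inj.
have iter_qp n : exists e, forall x, iter n (qp h) x = qp e x.
  elim: n => [|n [e eE]].
    exists (fun i => if i == 0%N then 1 else 0) => x.
    by rewrite /qp big_ord_recl /= expn0 expr1 mul1r big1 ?addr0 // => i _; rewrite mul0r.
  by exists (qcomp h e) => x; rewrite -qp_comp -eE.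
pose s := perm h_inj; have [e eE] := iter_qp #[s]%g.-1.
exists e => y; rewrite -eE -iterS prednK ?order_gt0 //.
rewrite -[RHS](perm1 y) -(expg_order s) permX; apply: eq_iter => x.
by rewrite permE.
Qed.

(** * Linear fractional maps between slope sets *)

Definition three_term (c A B : L) (i : nat) : L :=
  if i == 0%N then c else two_term 1 A B i.

Lemma qp_three_term (c A B x : L) :
  qp (three_term c A B) x = c * x + qp (two_term 1 A B) x.
Proof.
rewrite qp_two_term // /qp !big_ord_recl big_ord0 /three_term /two_term /=.
by rewrite expn0 expr1; ring.
Qed.

Lemma mem_slopes_three_term (c A B u : L) :
  (u \in slopes (three_term c A B)) = (u - c \in slopes (two_term 1 A B)).
Proof.
apply/slopesP/slopesP => -[x x0 E]; exists x => //.
  by rewrite mulrBl -E qp_three_term addrC addKr.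
by rewrite qp_three_term E mulrBl addrC subrK.
Qed.

Lemma eq_slopes_three_term (c A B A' B' : L) :
  slopes (three_term c A B) = slopes (three_term c A' B') ->
  slopes (two_term 1 A B) = slopes (two_term 1 A' B').
Proof.
move=> E; apply/setP => u.
by rewrite -(addrK c u) -!mem_slopes_three_term E.
Qed.

Lemma eq_qp_slopes (a b : nat -> L) : (forall x, qp a x = qp b x) ->
  slopes a = slopes b.
Proof. by move=> ab; apply: eq_imset => x; rewrite ab. Qed.

(** The q^4-conjugate of [z ^+ (q ^ 5) / z ^+ q] is its inverse, since 5 + 4 is 1 modulo 8. *)
Lemma norm_frob_ratio (delta z : L) : z != 0 ->
  delta * z ^+ (q ^ 5) / z ^+ q * (delta * z ^+ (q ^ 5) / z ^+ q) ^+ (q ^ 4) =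
  delta * delta ^+ (q ^ 4).
Proof.
move=> z0; change (z ^+ q) with (z ^+ (q ^ 1)); rewrite !exprMn exprVn !frob_frob.
rewrite -[((5 + 4) %% 8)%N]/1%N -[((1 + 4) %% 8)%N]/5%N.
by field; rewrite !frob_eq0 z0.
Qed.

Section LinearFractional.
Variables delta theta : L.
Let f := two_term 1 1 delta.
Let g := two_term 1 1 theta.

(** The image slopes are those of b x + d f(x); comparing the coefficients of index 0 gives b =
    0. *)
Lemma affine_slopes_norm (b d : L) : d != 0 ->
  (forall u, (u \in slopes f) -> b + d * u \in slopes g) ->
  (forall v, v \in slopes g -> exists2 u, u \in slopes f & v = b + d * u) ->
  theta * theta ^+ (q ^ 4) = delta * delta ^+ (q ^ 4).
Proof.
move=> d0 fg gf; apply: (eq_slopes_norm15 d0).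
apply: (@eq_slopes_three_term b).
have E : slopes (three_term b d (d * delta)) = slopes g.
  apply/setP => v; apply/idP/idP.
    case/slopesP => x x0; rewrite qp_three_term => E.
    have uf : qp f x / x \in slopes f by apply/slopesP; exists x; rewrite ?divfK.
    suff -> : v = b + d * (qp f x / x) by apply: fg.
    apply: (mulIf x0); rewrite -E mulrDl -mulrA divfK // !qp_two_term //; ring.
  case/gf => u /slopesP[x x0 E] ->; apply/slopesP; exists x => //.
  by rewrite mulrDl -(mulrA d u) -E qp_three_term !qp_two_term //; ring.
have b0 : b = 0 by have := eq_slopes0 E.
rewrite E b0; apply: eq_qp_slopes => x.
by rewrite qp_three_term mul0r add0r.
Qed.

Lemma inverse_slopes_norm (alpha beta gamma : L) : beta != 0 ->
  (forall u, u \in slopes f -> u + gamma != 0) ->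
  (forall u, u \in slopes f -> alpha + beta / (u + gamma) \in slopes g) ->
  (forall v, v \in slopes g ->
     exists2 u, u \in slopes f & v = alpha + beta / (u + gamma)) ->
  theta * theta ^+ (q ^ 4) = delta * delta ^+ (q ^ 4).
Proof.
move=> beta0 f0 fg gf; pose h := three_term gamma 1 delta.
have hE x : qp h x = gamma * x + qp f x by rewrite qp_three_term.
have slope_f x : x != 0 -> qp f x / x \in slopes f.
  by move=> x0; apply/slopesP; exists x; rewrite ?divfK.
have hE' x : x != 0 -> qp h x = (qp f x / x + gamma) * x.
  by move=> x0; rewrite hE mulrDl divfK // addrC.
have h0 x : x != 0 -> qp h x != 0.
  by move=> x0; rewrite hE' // mulf_neq0 // f0 // slope_f.
have h_inj : injective (qp h).
  move=> x y xy; apply/eqP; rewrite -subr_eq0; apply/negPn/negP => /h0.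
  rewrite -[x in qp h (x - y)](subrK y) addrK.
  by rewrite -(inj_eq (addIr (qp h y))) -qpD subrK add0r xy eqxx.
have [e eK] := qp_inverse h_inj.
have eK' : cancel (qp h) (qp e) by move=> x; apply: h_inj.
have qpZ a c x : qp (fun i => c * a i) x = c * qp a x.
  by rewrite /qp mulr_sumr; apply: eq_bigr => i _; rewrite mulrA.
pose k i := beta * e i.
have kE x : qp k x = beta * qp e x by rewrite qpZ.
(* At y = h(x) the slope of [k] is beta x / h(x) = beta / (u + gamma), with u the slope of [f] at
   x. *)
have S : slopes k = slopes (three_term (- alpha) 1 theta).
  apply/setP => v; rewrite mem_slopes_three_term opprK; apply/slopesP/idP.
    case=> y y0; rewrite kE => E; pose x := qp e y.
    have x0 : x != 0 by apply: contra y0 => /eqP x0; rewrite -(eK y) -/x x0 qp0.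
    suff -> : v + alpha = alpha + beta / (qp f x / x + gamma) by apply/fg/slope_f.
    rewrite addrC; congr (_ + _); apply: (mulIf y0); rewrite -E -/x.
    by rewrite -(eK y) -/x hE' // mulrA divfK // f0 // slope_f.
  case/gf => u uf /esym E; have [x x0 Ex] := slopesP _ _ uf.
  have uE : u = qp f x / x by rewrite Ex mulfK.
  exists (qp h x); first exact: h0.
  rewrite kE eK' hE' // -uE.
  have -> : v = beta / (u + gamma) by apply: (addIr alpha); rewrite -E addrC.
  by rewrite mulrA divfK // f0.
(* Comparison of the coefficients of index [i] in [h] composed with [e] and in the identity. *)
have H i : (i < 8)%N -> gamma * e i + e ((i + 7) %% 8)%N ^+ (q ^ 1) +
    delta * e ((i + 3) %% 8)%N ^+ (q ^ 5) = (i == 0%N)%:R.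
  move=> i8; have := @qp_inj (qcomp h e) (fun i => (i == 0%N)%:R) _ i i8.
  move=> <-; last first.
    move=> x; rewrite -qp_comp eK.
    by rewrite /qp big_ord_recl /= expn0 expr1 mul1r big1 ?addr0 // => j _; rewrite mul0r.
  rewrite /qcomp !big_ord_recl big_ord0 /h /three_term /two_term /=.
  rewrite subn0 modnDr (modn_small i8) expn0 expr1 !mul0r mul1r !addr0 !add0r.
  by rewrite -!addnBA // addrA.
(* The right-hand side of [S] has coefficients only at 0, 1 and 5, so the sums of exponent 1 + q^j
   for j = 4, 2, 1 make products of coefficients of [e] vanish. *)
have k4 : e 4 = 0.
  have := eq_slopes2 (j := 4) isT S; rewrite /k mul0r => /eqP.
  by rewrite mulf_eq0 frob_eq0 orbb mulf_eq0 (negPf beta0) => /eqP.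
have k26 : (e 2 == 0) || (e 6 == 0).
  have := eq_slopes2 (j := 2) isT S; rewrite /k mul0r => /eqP.
  by rewrite mulf_eq0 frob_eq0 !mulf_eq0 (negPf beta0).
have k17 : (e 1%N == 0) || (e 7 == 0).
  have := eq_slopes2 (j := 1) isT S; rewrite /k [RHS]/= frob0 mulr0 => /eqP.
  by rewrite mulf_eq0 frob_eq0 !mulf_eq0 (negPf beta0).
have k0 : beta * e 0%N = - alpha := eq_slopes0 S.
have H0 : gamma * e 0%N + e 7 ^+ (q ^ 1) + delta * e 3 ^+ (q ^ 5) = 1 := H 0%N isT.
have H1 : gamma * e 1%N + e 0%N ^+ (q ^ 1) + delta * e 4 ^+ (q ^ 5) = 0 := H 1%N isT.
have H2 : gamma * e 2 + e 1%N ^+ (q ^ 1) + delta * e 5 ^+ (q ^ 5) = 0 := H 2 isT.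
have H3 : gamma * e 3 + e 2 ^+ (q ^ 1) + delta * e 6 ^+ (q ^ 5) = 0 := H 3 isT.
have H4 : gamma * e 4 + e 3 ^+ (q ^ 1) + delta * e 7 ^+ (q ^ 5) = 0 := H 4 isT.
have H5 : gamma * e 5 + e 4 ^+ (q ^ 1) + delta * e 0%N ^+ (q ^ 5) = 0 := H 5 isT.
have H6 : gamma * e 6 + e 5 ^+ (q ^ 1) + delta * e 1%N ^+ (q ^ 5) = 0 := H 6 isT.
have H7 : gamma * e 7 + e 6 ^+ (q ^ 1) + delta * e 2 ^+ (q ^ 5) = 0 := H 7 isT.
have [g0|g0] := eqVneq gamma 0.
  (* With gamma = 0, the equations of index i and i + 4 involve the same two coefficients of [e], so
     the system splits into four pairs. *)
  rewrite {}g0 !mul0r !add0r in H0 H1 H2 H3 H4 H5 H6 H7.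
  have step x y : y ^+ (q ^ 1) + delta * x ^+ (q ^ 5) = 0 ->
      y ^+ (q ^ 5) = - (delta ^+ (q ^ 4) * x ^+ (q ^ 1)).
    move=> /eqP; rewrite addr_eq0 => /eqP /(congr1 (fun z => z ^+ (q ^ 4))).
    by rewrite frobN exprMn !frob_frob.
  (* Eliminating [e 3] from [H0] and [H4] leaves this factor times [e 7 ^+ (q ^ 1)] equal to 1. *)
  have D1 : 1 - delta * delta ^+ (q ^ 4) != 0.
    apply/eqP => D1; have /eqP := H0; rewrite (step _ _ H4).
    rewrite mulrN mulrA -[X in X - _]mul1r -mulrBl D1 mul0r.
    by rewrite eq_sym oner_eq0.
  have vanish x y : x ^+ (q ^ 1) + delta * y ^+ (q ^ 5) = 0 ->
      y ^+ (q ^ 1) + delta * x ^+ (q ^ 5) = 0 -> x = 0.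
    move=> /eqP Ex /step Ey; move: Ex; rewrite Ey mulrN mulrA -[X in X - _]mul1r -mulrBl.
    by rewrite mulf_eq0 (negPf D1) frob_eq0 => /eqP.
  have e0 := vanish _ _ H1 H5.
  have [e1 e5] := conj (vanish _ _ H2 H6) (vanish _ _ H6 H2).
  have [e2 e6] := conj (vanish _ _ H3 H7) (vanish _ _ H7 H3).
  have e7 : e 7 != 0.
    apply/eqP => e7; have /eqP := H0; rewrite (step _ _ H4) e7 !frob0.
    by rewrite mulr0 oppr0 mulr0 addr0 eq_sym oner_eq0.
  have e3 : e 3 ^+ (q ^ 1) = - delta * e 7 ^+ (q ^ 5).
    by apply/eqP; rewrite mulNr -addr_eq0 H4.
  rewrite (@eq_slopes_norm37 (beta * e 7) (e 3 / e 7)) ?mulf_neq0 //.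
    rewrite exprMn -exprM mulnC exprM.
    change (e 3 ^+ q = - delta * e 7 ^+ (q ^ 5)) in e3.
    by rewrite expr_div_n e3 norm_frob_ratio // frobN mulrNN.
  have -> : beta * e 7 * (e 3 / e 7) = k 3 by rewrite /k; field.
  have -> : slopes (two_term 3 (k 3) (beta * e 7)) = slopes k.
    apply: eq_qp_slopes => x; rewrite qp_two_term // /qp !big_ord_recl big_ord0 /= /bump /=.
    by rewrite /k e0 e1 e2 k4 e5 e6; ring.
  rewrite S; apply: eq_qp_slopes => x; rewrite qp_three_term.
  by rewrite -k0 e0 mulr0 mul0r add0r.
have cancelg x : gamma * x = 0 -> x = 0.
  by move/eqP; rewrite mulf_eq0 (negPf g0) => /eqP.
(* If [e 0] vanished, the recursion would kill the coefficients 1 and 5, then 2 and 6, then 3 and 7,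
   contradicting [H0]. *)
have e0 : e 0%N != 0.
  apply/eqP => e0.
  rewrite e0 k4 ?frob0 ?mulr0 ?addr0 ?add0r in H0 H1 H2 H3 H4 H5 H6 H7.
  move/cancelg in H1; move/cancelg in H5.
  rewrite H1 H5 ?frob0 ?mulr0 ?addr0 ?add0r in H2 H6.
  move/cancelg in H2; move/cancelg in H6.
  rewrite H2 H6 ?frob0 ?mulr0 ?addr0 ?add0r in H3 H7.
  move/cancelg in H3; move/cancelg in H7.
  move/eqP: H0; rewrite H3 H7 !frob0 mulr0 addr0 eq_sym oner_eq0 //.
rewrite k4 ?frob0 ?mulr0 ?addr0 ?add0r in H1 H4 H5.
have e1 : e 1%N != 0.
  by apply: contra_eq_neq H1 => ->; rewrite mulr0 add0r frob_eq0.
have e7 : e 7 = 0 by apply/eqP; move: k17; rewrite (negPf e1).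
rewrite e7 frob0 ?mulr0 ?addr0 ?add0r in H4 H7.
have e3 : e 3 = 0 by apply/eqP; rewrite -(frob_eq0 1) H4.
rewrite e3 mulr0 add0r in H3.
have [e2 e6] : e 2 = 0 /\ e 6 = 0.
  case/orP: k26 => /eqP E; rewrite E !frob0 ?mulr0 ?addr0 ?add0r in H3 H7.
    by split=> //; apply/eqP; rewrite -(frob_eq0 1) H7.
  by split=> //; apply/eqP; rewrite -(frob_eq0 1) H3.
(* By [H1] and [H5], the ratio of [e 5] to [e 1] is [delta] times [e 0 ^+ (q ^ 5) / e 0 ^+ q], which
   has the norm of [delta]. *)
rewrite (@eq_slopes_norm15 (beta * e 1%N) (e 5 / e 1%N)) ?mulf_neq0 //.
  rewrite -(norm_frob_ratio delta e0).
  suff -> : e 5 / e 1%N = delta * e 0%N ^+ (q ^ 5) / e 0%N ^+ q by [].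
  move/eqP: H1; rewrite addr_eq0 expn1 -eqr_oppLR => /eqP <-.
  move/eqP: H5; rewrite addrC addr_eq0 => /eqP ->.
  by field; rewrite oppr_eq0 mulf_neq0.
have -> : beta * e 1%N * (e 5 / e 1%N) = k 5 by rewrite /k; field.
apply: (@eq_slopes_three_term (- alpha)); rewrite -S; apply: eq_qp_slopes => x.
rewrite qp_three_term -k0 qp_two_term // /qp !big_ord_recl big_ord0 /= /bump /=.
by rewrite /k e2 e3 k4 e6 e7 expn0 expr1; ring.
Qed.

(** For nonzero [c], division with remainder writes the map as d/c plus a multiple of 1 / (u +
    a/c). *)
Lemma mobius_slopes_norm (a b c d : L) : a * d - b * c != 0 ->
  (forall u, u \in slopes f -> a + c * u != 0) ->
  (forall u, u \in slopes f -> (b + d * u) / (a + c * u) \in slopes g) ->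
  (forall v, v \in slopes g ->
     exists2 u, u \in slopes f & v = (b + d * u) / (a + c * u)) ->
  theta * theta ^+ (q ^ 4) = delta * delta ^+ (q ^ 4).
Proof.
move=> det0 f0 fg gf; have [c0|c0] := eqVneq c 0.
  rewrite c0 mulr0 subr0 mulf_eq0 negb_or in det0; case/andP: det0 => a0 d0.
  have E u : (b + d * u) / (a + c * u) = b / a + d / a * u.
    by rewrite c0 mul0r addr0; field.
  apply: (@affine_slopes_norm (b / a) (d / a)).
  - by rewrite mulf_neq0 ?invr_eq0.
  - by move=> u /fg; rewrite E.
  - by move=> v /gf[u uf ->]; exists u; rewrite ?E.
have E u : a + c * u != 0 ->
    (b + d * u) / (a + c * u) = d / c + - (a * d - b * c) / c ^+ 2 / (u + a / c).
  by move=> u0; field; rewrite c0 mulrC addrC.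
have f0' u : u \in slopes f -> u + a / c != 0.
  move=> /f0; rewrite -(mulrI_eq0 (u + _) (mulfI c0)) mulrDr.
  by rewrite mulrCA divff // mulr1 addrC.
apply: (@inverse_slopes_norm (d / c) (- (a * d - b * c) / c ^+ 2) (a / c)) => //.
- by rewrite mulf_neq0 ?oppr_eq0 ?invr_eq0 ?expf_neq0.
- by move=> u uf; rewrite -E ?fg ?f0.
- by move=> v /gf[u uf ->]; exists u; rewrite -?E ?f0.
Qed.

End LinearFractional.

(** For nonzero [delta], the quotient [theta / delta] has relative norm 1, so its exponent with
    respect to a generator is divisible by q^4 - 1; dividing that exponent yields [l0] with l0^(q^4
    - 1) equal to the quotient. *)
Lemma frobenius_hilbert90 (delta theta : L) :
  theta * theta ^+ (q ^ 4) = delta * delta ^+ (q ^ 4) ->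
  exists2 l : L, l != 0 & delta * l ^+ (q ^ 5) = theta * l ^+ q.
Proof.
have [->|d0] := eqVneq delta 0.
  rewrite mul0r => /eqP; rewrite mulf_eq0 frob_eq0 orbb => /eqP ->.
  by exists 1; rewrite ?oner_neq0 // !mul0r.
move=> N; pose mu := theta / delta.
have mu1 : mu ^+ (q ^ 4).+1 = 1.
  by rewrite exprS expr_div_n mulrACA N -invfM divff // mulf_neq0 // frob_eq0.
have [w wP] := finField_prim_root L.
have mu0 : mu != 0.
  by apply: contra_eq_neq mu1 => ->; rewrite expr0n eq_sym oner_neq0.
have [[j _] /= muE] := prim_rootP wP (finField_expf_pred mu0).
have q4 : (0 < q ^ 4)%N by rewrite expn_gt0 q_gt0.
have dvd_j : ((q ^ 4).-1 %| j)%N.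
  have : (#|L|.-1 %| j * (q ^ 4).+1)%N.
    by rewrite (prim_order_dvd wP) exprM -muE mu1.
  have -> : (#|L|.-1 = (q ^ 4).-1 * (q ^ 4).+1)%N by rewrite cardL (expnM q 4 2); nia.
  by rewrite dvdn_pmul2r.
have w0 := prim_root_neq0 wP.
pose l0 := w ^+ (j %/ (q ^ 4).-1).
have l0E : l0 ^+ (q ^ 4) = mu * l0.
  by rewrite -(prednK q4) exprSr -exprM divnK // -muE.
have l0n : l0 != 0 by rewrite expf_neq0.
(* The power q^7 makes l^q = l0 and l^(q^5) = l0^(q^4). *)
exists (l0 ^+ (q ^ 7)); first by rewrite frob_eq0.
rewrite frob_frob -[((7 + 5) %% 8)%N]/4%N l0E -exprM -expnSr frob8 mulrA.
by rewrite /mu (mulrC delta) divfK.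
Qed.

Lemma horner_qpoly15 (d x : L) : (qpoly15 q d).[x] = qp (two_term 1 1 d) x.
Proof. by rewrite qp_two_term // mul1r /qpoly15 !hornerE. Qed.

Lemma rmorph_qp15 (s : {rmorphism L -> L}) (d x : L) :
  s (qp (two_term 1 1 d) x) = qp (two_term 1 1 (s d)) (s x).
Proof. by rewrite !qp_two_term // !mul1r rmorphD rmorphM !rmorphXn. Qed.

End QPolynomials.

(** * Equivalence of linear sets *)

Section Spans.
Variable L : finFieldType.

Lemma scale_pair_rV (k x y : L) : k *: pair_rV x y = pair_rV (k * x) (k * y).
Proof. by apply/rowP => i; rewrite !mxE; case: ifP. Qed.

Lemma pair_rV_inj (x y x' y' : L) :
  pair_rV x y = pair_rV x' y' -> x = x' /\ y = y'.
Proof.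
by move=> /rowP E; have := E 0; have := E 1; rewrite !mxE.
Qed.

Lemma lspan_eq (v w : 'rV[L]_2) : lspan v = lspan w -> exists k, v = k *: w.
Proof.
move=> E; have : v \in lspan v by apply/imsetP; exists 1; rewrite ?scale1r.
by rewrite E => /imsetP[k _ ->]; exists k.
Qed.

Lemma semilin_lspan (A : 'M[L]_2) (s : {rmorphism L -> L}) (v : 'rV[L]_2) :
  bijective s -> semilin A s @: lspan v = lspan (semilin A s v).
Proof.
move=> [s' sK s'K].
have sZ k u : semilin A s (k *: u) = s k *: semilin A s u.
  by rewrite /semilin map_mxZ scalemxAl.
apply/setP => w; apply/imsetP/imsetP => [[_ /imsetP[k _ ->] ->]|[k _ ->]].
  by exists (s k); rewrite ?sZ.
by exists (s' k *: v); rewrite ?sZ ?s'K //; apply/imsetP; exists (s' k).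
Qed.

Lemma semilin_pair_rV (A : 'M[L]_2) (s : {rmorphism L -> L}) (x y : L) :
  semilin A s (pair_rV x y) =
  pair_rV (A 0 0 * s x + A 1 0 * s y) (A 0 1 * s x + A 1 1 * s y).
Proof.
apply/rowP => j; rewrite !mxE big_ord_recl big_ord1 !mxE /=.
have -> : lift 0 0 = 1 :> 'I_2 by apply: val_inj.
rewrite !(mulrC (s _)); case: eqP => [->//|j0].
suff -> : j = 1 by [].
by case: j j0 => [[|[|]] lt_j] // j0; [case: j0|]; apply: val_inj.
Qed.

Lemma det_mx22 (A : 'M[L]_2) : \det A = A 0 0 * A 1 1 - A 0 1 * A 1 0.
Proof.
rewrite (expand_det_row _ 0) big_ord_recl big_ord1 /cofactor !det_mx11 !mxE /=.
have -> : lift 0 0 = 1 :> 'I_2 by apply: val_inj.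
have -> : lift 1 0 = 0 :> 'I_2 by apply: val_inj.
by rewrite addn0 expr0 mul1r addn1 expr1 mulN1r mulrN.
Qed.

End Spans.

(** * Semilinear equivalences and the action on slopes *)

Section Equivalence.
Variables (q : nat) (L : finFieldType).
Hypotheses (q_pp : prime_power q) (cardL : #|L| = (q ^ 8)%N).

Lemma linset_memP (d : L) (P : {set 'rV[L]_2}) :
  reflect (exists2 x, x != 0 & P = lspan (pair_rV x (qp q (two_term 1 1 d) x)))
          (P \in linset (qpoly15 q d)).
Proof.
apply: (iffP imsetP) => -[x].
  by rewrite inE => x0 ->; exists x; rewrite ?horner_qpoly15.
by move=> x0 ->; exists x; rewrite ?inE // horner_qpoly15.
Qed.

Lemma PGammaL_equiv_norm (delta theta : L) :
  PGammaL_equiv (linset (qpoly15 q delta)) (linset (qpoly15 q theta)) ->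
  exists s : {rmorphism L -> L},
    theta * theta ^+ (q ^ 4) = s delta * s delta ^+ (q ^ 4).
Proof.
case=> phi [A [s [A_unit s_bij phiE]]] phi_fg; exists s.
have [s' sK s'K] := s_bij.
pose f := two_term 1 1 (s delta); pose g := two_term 1 1 theta.
(* After [s], the matrix acts on the slope [u] of the conjugated polynomial as a linear fractional
   map; its denominator is nonzero because the image point has nonzero first coordinate [y]. *)
have step x y : x != 0 -> y != 0 ->
    phi (lspan (pair_rV x (qp q (two_term 1 1 delta) x))) =
      lspan (pair_rV y (qp q g y)) ->
    let u := qp q f (s x) / s x in
    A 0 0 + A 1 0 * u != 0 /\
    qp q g y / y = (A 0 1 + A 1 1 * u) / (A 0 0 + A 1 0 * u).
  move=> x0 y0; rewrite phiE; last first.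
    by apply/(subsetP (linset_sub_PG1 (qpoly15 q delta)))/linset_memP; exists x.
  rewrite semilin_lspan // semilin_pair_rV rmorph_qp15 // -/f.
  case/esym/lspan_eq => k; rewrite scale_pair_rV => /pair_rV_inj[yE gE] u.
  have sx0 : s x != 0 by rewrite fmorph_eq0.
  have fE : qp q f (s x) = u * s x by rewrite divfK.
  rewrite fE mulrA -mulrDl mulrA in yE; rewrite fE mulrA -mulrDl mulrA in gE.
  move: (y0); rewrite yE !mulf_eq0 !negb_or -andbA => /and3P[k0 c0 _].
  by split=> //; rewrite -yE gE yE; field; rewrite k0 sx0 c0.
apply: (@mobius_slopes_norm q L q_pp cardL (s delta) theta
          (A 0 0) (A 0 1) (A 1 0) (A 1 1)).
- by move: A_unit; rewrite unitmxE unitfE det_mx22.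
- move=> u /slopesP[x x0 E].
  have x'0 : s' x != 0 by rewrite -(fmorph_eq0 s) s'K.
  have : phi (lspan (pair_rV (s' x) (qp q (two_term 1 1 delta) (s' x)))) \in
      linset (qpoly15 q theta).
    by rewrite -phi_fg imset_f //; apply/linset_memP; exists (s' x).
  case/linset_memP => y y0 /(step _ _ x'0 y0) /= [+ _].
  by rewrite s'K /f E mulfK.
- move=> u /slopesP[x x0 E].
  have x'0 : s' x != 0 by rewrite -(fmorph_eq0 s) s'K.
  have : phi (lspan (pair_rV (s' x) (qp q (two_term 1 1 delta) (s' x)))) \in
      linset (qpoly15 q theta).
    by rewrite -phi_fg imset_f //; apply/linset_memP; exists (s' x).
  case/linset_memP => y y0 /(step _ _ x'0 y0) /= [_].
  by rewrite s'K /f E mulfK // => <-; apply/slopesP; exists y; rewrite ?divfK.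
- move=> v /slopesP[y y0 E].
  have : lspan (pair_rV y (qp q g y)) \in phi @: linset (qpoly15 q delta).
    by rewrite phi_fg; apply/linset_memP; exists y.
  case/imsetP => _ /linset_memP[x x0 ->] /esym /(step _ _ x0 y0) /= [_ gE].
  exists (qp q f (s x) / s x); last by rewrite -gE E mulfK.
  by apply/slopesP; exists (s x); rewrite ?divfK ?fmorph_eq0.
Qed.

Lemma norm_PGammaL_equiv (delta theta : L) (s : {rmorphism L -> L}) :
  theta * theta ^+ (q ^ 4) = s delta * s delta ^+ (q ^ 4) ->
  PGammaL_equiv (linset (qpoly15 q delta)) (linset (qpoly15 q theta)).
Proof.
move=> /(frobenius_hilbert90 q_pp cardL)[l l0 lE].
have s_bij : bijective s by apply: injF_bij; exact: fmorph_inj.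
have [s' sK s'K] := s_bij.
(* The map (x, y) to (x / l, y / l^q) normalizes the coefficient of index 1; the equation [lE] is
   exactly what turns [s delta] into [theta] at index 5. *)
pose A : 'M[L]_2 := diag_mx (pair_rV l^-1 (l ^- q)).
have lq0 : l ^+ q != 0 by rewrite expf_neq0.
have A00 : A 0 0 = l^-1 by rewrite !mxE.
have A11 : A 1 1 = l ^- q by rewrite !mxE.
have A01 : A 0 1 = 0 by rewrite !mxE.
have A10 : A 1 0 = 0 by rewrite !mxE.
have phiE x : x != 0 ->
    semilin A s @: lspan (pair_rV x (qp q (two_term 1 1 delta) x)) =
    lspan (pair_rV (s x / l) (qp q (two_term 1 1 theta) (s x / l))).
  move=> x0; rewrite semilin_lspan // semilin_pair_rV rmorph_qp15 //.
  rewrite A00 A11 A01 A10 !mul0r addr0 add0r (mulrC l^-1); congr (lspan (pair_rV _ _)).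
  rewrite !qp_two_term // !expr_div_n !mul1r.
  have -> : s delta = theta * l ^+ q / l ^+ (q ^ 5) by rewrite -lE mulfK ?expf_neq0.
  by rewrite expn1; field; rewrite lq0 expf_neq0.
exists (fun P : {set 'rV[L]_2} => semilin A s @: P).
  exists A, s; split=> //.
  rewrite unitmxE unitfE det_mx22 A00 A11 A01 mul0r subr0.
  by rewrite mulf_neq0 ?invr_eq0.
apply/setP => P; apply/imsetP/linset_memP.
  case=> _ /linset_memP[x x0 ->] ->; exists (s x / l); last exact: phiE.
  by rewrite mulf_neq0 ?invr_eq0 ?fmorph_eq0.
case=> y y0 ->; have x0 : s' (l * y) != 0.
  by rewrite -(fmorph_eq0 s) s'K mulf_neq0.
exists (lspan (pair_rV (s' (l * y)) (qp q (two_term 1 1 delta) (s' (l * y))))).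
  by apply/linset_memP; exists (s' (l * y)).
by rewrite phiE // s'K mulrC mulKf.
Qed.

End Equivalence.

(** The two Frobenius exponents add up to i n, and the power p^(i n) is the identity on [F]. *)
Lemma expf_Frobenius_inv (F : finFieldType) (p n i : nat) (x y : F) :
  (0 < n)%N -> #|F| = (p ^ n)%N -> y = x ^+ (p ^ i) -> x = y ^+ (p ^ (i * n.-1)).
Proof.
move=> n0 cardF ->; rewrite -exprM -expnD -mulnS prednK // mulnC expnM -cardF.
by elim: i => [|i IH]; rewrite ?expn0 ?expr1 // expnS exprM expf_card -IH.
Qed.

Theorem theorem4p9 (q : nat) (q_pp : prime_power q)
    (L : finFieldType) (cardL : #|L| = (q ^ 8)%N)
    (K : finFieldType) (cardK : #|K| = (q ^ 4)%N) (iota : {rmorphism K -> L})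
    (delta theta : L) :
  PGammaL_equiv (linset (qpoly15 q delta)) (linset (qpoly15 q theta))
  <-> exists2 sigma : {rmorphism K -> K},
        bijective sigma & relnorm iota delta = sigma (relnorm iota theta).
Proof.
have cardLK : #|L| = (#|K| ^ 2)%N by rewrite cardL cardK -expnM.
have normE x : x * x ^+ (q ^ 4) = iota (relnorm iota x).
  by rewrite relnormE // exprS cardK.
have [p [e [p_pr e0 qE]]] := q_pp.
have cardL' : #|L| = (p ^ (e * 8))%N by rewrite cardL qE expnM.
have cardK' : #|K| = (p ^ (e * 4))%N by rewrite cardK qE expnM.
split=> [/(PGammaL_equiv_norm q_pp cardL)[s]|[sigma _]].
  (* Being a Frobenius power, [s] acts on the norms by a power map that also makes sense on [K]; its
     inverse there moves the automorphism from [delta] to [theta]. *)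
  have [i sE] := finField_rmorphE p_pr cardL' s.
  rewrite -[s delta ^+ _]rmorphXn -rmorphM !normE sE -rmorphXn => /fmorph_inj.
  move/(expf_Frobenius_inv _ cardK'); rewrite muln_gt0 e0 => /(_ isT) nE.
  have [sigma sigmaE] := Frobenius_rmorphism p_pr cardK' (i * (e * 4).-1).
  exists sigma; last by rewrite sigmaE.
  by apply: injF_bij; exact: fmorph_inj.
(* Conversely [sigma] is a power map, so its inverse extends to [L] as a Frobenius power. *)
have [i ->] := finField_rmorphE p_pr cardK' sigma => /(congr1 iota).
rewrite rmorphXn; move/(expf_Frobenius_inv _ cardL'); rewrite muln_gt0 e0 => /(_ isT).
have [s sE] := Frobenius_rmorphism p_pr cardL' (i * (e * 8).-1).
rewrite -sE -!normE rmorphM rmorphXn; exact: norm_PGammaL_equiv.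
Qed.
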